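(* Let $m,n$ be positive integers and let $\mathcal{A}$ and $\mathcal{B}$ be real symmetric $m$-th order $n$-dimensional tensors, with $\mathcal{B}$ strictly copositive. Let $\lambda(x)=\mathcal{A}x^m/\mathcal{B}x^m$ and let $\bar x$ be a stationary point of the optimization problem $$\max\{\lambda(x): x\in S\},\qquad S=\Big\{x\in\mathbb{R}^n_+:\sum_{i=1}^n x_i=1\Big\}.$$ Then $(\lambda(\bar x),\bar x)$ satisfies $$\bar x\ne 0,\quad \bar x\ge 0,\qquad \lambda(\bar x)\,\mathcal{B}\bar x^{m-1}-\mathcal{A}\bar x^{m-1}\ge 0,\qquad \langle \bar x,\ \lambda(\bar x)\,\mathcal{B}\bar x^{m-1}-\mathcal{A}\bar x^{m-1}\rangle=0.$$
   Context: A real $m$-th order $n$-dimensional tensor is an array $\mathcal{A}=(a_{i_1\cdots i_m})$ with $a_{i_1\cdots i_m}\in\mathbb{R}$ for $1\le i_1,\ldots,i_m\le n$; it is symmetric if its entries are invariant under any permutation of their indices. For $x\in\mathbb{R}^n$, $\mathcal{A}x^{m-1}\in\mathbb{R}^n$ is the vector with $(\mathcal{A}x^{m-1})_i=\sum_{i_2,\ldots,i_m=1}^n a_{ii_2\cdots i_m}x_{i_2}\cdots x_{i_m}$, and $\mathcal{A}x^m=\sum_{i_1,\ldots,i_m=1}^n a_{i_1\cdots i_m}x_{i_1}\cdots x_{i_m}$. Vector inequalities are componentwise and $\mathbb{R}^n_+=\{x\in\mathbb{R}^n:x\ge 0\}$. $\mathcal{B}$ is strictly copositive if $\mathcal{B}x^m>0$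 for all $x\in\mathbb{R}^n_+\setminus\{0\}$. A stationary point of the problem is a point $\bar x\in S$ satisfying the first-order (KKT) conditions: there exist $\bar\alpha\in\mathbb{R}^n$ and $\bar\beta\in\mathbb{R}$ with $-\nabla\lambda(\bar x)=\bar\alpha+\bar\beta e$, $\bar\alpha\ge 0$, $\bar\alpha^\top\bar x=0$, where $e\in\mathbb{R}^n$ is the vector of ones. *)

(* Defs.v *)
From HB Require Import structures.
From mathcomp Require Import all_boot all_order all_algebra all_fingroup.
From mathcomp Require Import all_classical all_reals all_analysis.

Set Implicit Arguments.
Unset Strict Implicit.
Unset Printing Implicit Defensive.

Import Order.TTheory GRing.Theory Num.Theory.
Import numFieldNormedType.Exports.

Local Open Scope classical_set_scope.
Local Open Scope ring_scope.

Section Tensors.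
Variables (R : realType) (n : nat).
Implicit Types (u v x : 'rV[R]_n).

Definition tensor (m : nat) := m.-tuple 'I_n -> R.

Definition symmetric_tensor (m : nat) (A : tensor m) : Prop :=
  forall (s : 'S_m) (I : m.-tuple 'I_n),
    A [tuple tnth I (s k) | k < m] = A I.

(* The scalar A x^m *)
Definition tensor_form (m : nat) (A : tensor m) x : R :=
  \sum_(I : m.-tuple 'I_n) A I * \prod_(k < m) x 0 (tnth I k).

(* The vector A x^(m-1); the order of A is written m.+1, so that the index
   tuple (i, i_2, ..., i_m) is i followed by an arbitrary m-tuple. *)
Definition tensor_apply (m : nat) (A : tensor m.+1) x : 'rV[R]_n :=
  \row_i \sum_(J : m.-tuple 'I_n)
     A [tuple of i :: J] * \prod_(k < m) x 0 (tnth J k).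

Definition vec_nonneg x : Prop := forall i, 0 <= x 0 i.

Definition dot u v : R := \sum_i u 0 i * v 0 i.

Definition strictly_copositive (m : nat) (B : tensor m) : Prop :=
  forall x, vec_nonneg x -> x != 0 -> 0 < tensor_form B x.

Definition tensor_quotient (m : nat) (A B : tensor m) x : R :=
  tensor_form A x / tensor_form B x.

Definition simplex : set 'rV[R]_n :=
  [set x | vec_nonneg x /\ \sum_i x 0 i = 1].

Definition gradient (f : 'rV[R]_n -> R) x : 'rV[R]_n :=
  \row_i 'D_(delta_mx 0 i) f x.

(* First-order (KKT) conditions for maximizing f over the simplex *)
Definition stationary_point (f : 'rV[R]_n -> R) x : Prop :=
  simplex x /\
  exists (alpha : 'rV[R]_n) (beta : R),
    [/\ - gradient f x = alpha + beta *: const_mx 1,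
        vec_nonneg alpha
      & dot alpha x = 0].

End Tensors.

(* Main.v *)
Require Import Defs.
From HB Require Import structures.
From mathcomp Require Import all_boot all_order all_algebra all_fingroup.
From mathcomp Require Import all_classical all_reals all_analysis.
From mathcomp Require Import ring.
Import Order.TTheory GRing.Theory Num.Theory.
Import numFieldNormedType.Exports.
Local Open Scope ring_scope.

Set Implicit Arguments.
Unset Strict Implicit.

(** By symmetry of the tensors, [∇(A x^m) = m A x^(m-1)], so the quotient rule
gives [-∇λ(x) = (m / B x^m) w] with [w = λ(x) B x^(m-1) - A x^(m-1)].  Since
[<x, A x^(m-1)> = A x^m], the definition of [λ] gives [<x, w> = 0]; pairing the
KKT equation with [x], whose entries sum to [1], then forces [β = 0], and [w] is
a positive multiple of [α]. *)

(** Leibniz rule, by induction on the number of factors: the binary product rule peels off [h ord0],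
    and the induction hypothesis differentiates the rest. *)
Lemma is_derive_prod (R : realType) (V : normedModType R) (x v : V) (m : nat)
    (h : 'I_m -> V -> R) (dh : 'I_m -> R) :
  (forall k, is_derive x v (h k) (dh k)) ->
  is_derive x v (fun y => \prod_(k < m) h k y)
    (\sum_(k < m) dh k * \prod_(j < m | j != k) h j x).
Proof.
elim: m h dh => [|m IHm] h dh hdh.
  rewrite big_ord0 (_ : (fun _ => _) = cst 1); first exact: is_derive_cst.
  by apply/funext => y; rewrite big_ord0.
rewrite (_ : (fun _ => _) =
    h ord0 * (fun y => \prod_(k < m) h (lift ord0 k) y)); last first.
  by apply/funext => y; rewrite big_ord_recl.
apply: is_derive_eq; first exact: is_deriveM (hdh ord0) (IHm _ _ (fun k => hdh _)).
rewrite big_ord_recl addrC; congr (_ + _).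
  rewrite /GRing.scale/= mulrC; congr (_ * _).
  by rewrite [RHS]big_mkcond big_ord_recl/= mul1r.
rewrite /GRing.scale/= mulr_sumr; apply: eq_bigr => k _.
(* Turning the filter [j != k] into a conditional factor lets index 0 be split off; an excluded
   index then contributes 1. *)
rewrite mulrCA; congr (_ * _); rewrite [RHS]big_mkcond big_ord_recl/=; congr (_ * _).
by rewrite [LHS]big_mkcond; apply: eq_bigr => j _; rewrite (inj_eq lift_inj).
Qed.

Lemma is_derive_coord (R : realType) (n : nat) (x v : 'rV[R]_n) (i : 'I_n) :
  is_derive x v (fun y : 'rV[R]_n => y 0 i) (v 0 i).
Proof.
(* A coordinate is linear, so its difference quotient equals [v 0 i] for every nonzero [h]. *)
have dq : ((fun h : R => h^-1 *: ((h *: v + x) 0 i - x 0 i)) @ 0^' --> v 0 i)%classic.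
  apply: cvg_near_cst; near=> h.
  rewrite !mxE addrK /GRing.scale/= mulKf //.
  by near: h; exact: nbhs_dnbhs_neq.
by apply: DeriveDef; [apply/cvg_ex; exists (v 0 i) | exact: cvg_lim].
Unshelve. all: by end_near.
Qed.

Lemma big_tuple_cons (R : nmodType) (T : finType) (m : nat)
    (F : m.+1.-tuple T -> R) :
  \sum_(I : m.+1.-tuple T) F I =
  \sum_(i : T) \sum_(J : m.-tuple T) F [tuple of i :: J].
Proof.
rewrite pair_big /= (reindex (fun p : T * m.-tuple T => [tuple of p.1 :: p.2])) //=.
exists (fun I => (thead I, [tuple of behead I])) => [[i J] _|I _] /=.
  by congr (_, _); apply: val_inj.
by rewrite -tuple_eta.
Qed.

(** Differentiating the [k]-th factor of a monomial puts [u] in slot [k]. Swapping slots 0 and [k]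
    leaves [A] unchanged and moves [u] to the first slot, so the value does not depend on [k]. *)
Lemma sum_symmetric_tensor (R : realType) (n m : nat) (A : tensor R n m.+1)
    (u x : 'rV[R]_n) (k : 'I_m.+1) : symmetric_tensor A ->
  \sum_(I : m.+1.-tuple 'I_n)
     A I * (u 0 (tnth I k) * \prod_(j < m.+1 | j != k) x 0 (tnth I j)) =
  dot u (tensor_apply A x).
Proof.
move=> hA; pose s := tperm ord0 k.
pose f (I : m.+1.-tuple 'I_n) := [tuple tnth I (s j) | j < m.+1].
have fK : involutive f.
  by move=> I; apply: eq_from_tnth => j; rewrite !tnth_mktuple tpermK.
rewrite (reindex_inj (inv_inj fK)) big_tuple_cons.
apply: eq_bigr => i _; rewrite mxE mulr_sumr; apply: eq_bigr => J _.
rewrite hA tnth_mktuple tpermR tnth0 mulrCA; congr (_ * (_ * _)).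
under eq_bigr do rewrite tnth_mktuple.
(* Reindexing by [s] undoes the swap inside the product and turns the excluded index [k] into 0,
   leaving exactly the entries of [J]. *)
rewrite (reindex_inj (@perm_inj _ s)) /= big_mkcond big_ord_recl /=.
rewrite tpermL eqxx mul1r; apply: eq_bigr => j _.
by rewrite tpermK -(inj_eq (@perm_inj _ s)) tpermK tpermR tnthS.
Qed.

(** The Leibniz rule gives one sum per slot; by symmetry all [m.+1] of them coincide, whence the
    factor [m.+1%:R]. *)
Lemma is_derive_tensor_form (R : realType) (n m : nat) (A : tensor R n m.+1)
    (x v : 'rV[R]_n) : symmetric_tensor A ->
  is_derive x v (tensor_form A) (m.+1%:R * dot v (tensor_apply A x)).
Proof.
move=> hA.
rewrite (_ : tensor_form A = \sum_(I : m.+1.-tuple 'I_n)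
    (A I \*: (fun y : 'rV[R]_n => \prod_(k < m.+1) y 0 (tnth I k)))); last first.
  by apply/funext => y; rewrite fct_sumE.
rewrite (_ : _ * _ = \sum_(I : m.+1.-tuple 'I_n) A I *:
    \sum_(k < m.+1) v 0 (tnth I k) * \prod_(j < m.+1 | j != k) x 0 (tnth I j)).
  elim/big_ind2 : _ => [||I _]; first exact: is_derive_cst.
  - by move=> *; exact: is_deriveD.
  - by apply: is_deriveZ; apply: is_derive_prod => k; exact: is_derive_coord.
under eq_bigr do rewrite /GRing.scale/= mulr_sumr.
rewrite exchange_big /=; under eq_bigr do rewrite sum_symmetric_tensor //.
by rewrite sumr_const card_ord mulr_natl.
Qed.

Lemma tensor_form_dot (R : realType) (n m : nat) (A : tensor R n m.+1)
    (x : 'rV[R]_n) : tensor_form A x = dot x (tensor_apply A x).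
Proof.
rewrite /tensor_form big_tuple_cons; apply: eq_bigr => i _.
rewrite mxE mulr_sumr; apply: eq_bigr => J _.
rewrite big_ord_recl tnth0 mulrCA; congr (_ * (_ * _)).
by apply: eq_bigr => j _; rewrite tnthS.
Qed.

Lemma dot_delta (R : realType) (n : nat) (u : 'rV[R]_n) (i : 'I_n) :
  dot (delta_mx 0 i) u = u 0 i.
Proof.
rewrite /dot (bigD1 i)//= mxE !eqxx mul1r big1 ?addr0 // => j ji.
by rewrite mxE (negbTE ji) andbF mul0r.
Qed.

Lemma gradient_tensor_quotient (R : realType) (n m : nat)
    (A B : tensor R n m.+1) (x : 'rV[R]_n) :
  symmetric_tensor A -> symmetric_tensor B -> tensor_form B x != 0 ->
  - gradient (tensor_quotient A B) x =
  (m.+1%:R / tensor_form B x) *: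
    (tensor_quotient A B x *: tensor_apply B x - tensor_apply A x).
Proof.
move=> hA hB Bx_neq0; apply/rowP => i; rewrite !mxE.
have dA := is_derive_tensor_form x (delta_mx 0 i) hA.
have dB := is_derive_tensor_form x (delta_mx 0 i) hB.
(* The quotient is by conversion a product with a pointwise inverse, the shape that the product and
   inverse rules expect. *)
have -> : 'D_(delta_mx 0 i) (tensor_quotient A B) x =
    'D_(delta_mx 0 i) (tensor_form A * (fun y => (tensor_form B y)^-1)) x by [].
rewrite deriveM ?deriveV //; last exact: derivableV.
rewrite !derive_val !dot_delta /tensor_quotient /GRing.scale/=.
by rewrite !mxE; field.
Qed.

Theorem proposition3p1 (R : realType) (m n : nat) (hn : (0 < n)%N)
    (A B : tensor R n m.+1)
    (hA : symmetric_tensor A) (hB : symmetric_tensor B)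
    (hBpos : strictly_copositive B)
    (xbar : 'rV[R]_n)
    (hx : stationary_point (tensor_quotient A B) xbar) :
  let lam := tensor_quotient A B xbar in
  let w := lam *: tensor_apply B xbar - tensor_apply A xbar in
  [/\ xbar != 0, vec_nonneg xbar, vec_nonneg w & dot xbar w = 0].
Proof.
move=> lam w; case: hx => -[x_ge0 x_sum1] [alpha [beta [kkt alpha_ge0 alphax]]].
have x_neq0 : xbar != 0.
  apply/eqP => x0; move: x_sum1; rewrite x0 big1 => [/eqP|i _].
    by rewrite eq_sym oner_eq0.
  by rewrite mxE.
have Bx_gt0 := hBpos _ x_ge0 x_neq0.
have xw : dot xbar w = 0.
  transitivity (lam * tensor_form B xbar - tensor_form A xbar).
    rewrite !tensor_form_dot /dot mulr_sumr -sumrB; apply: eq_bigr => i _.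
    by rewrite !mxE mulrBr mulrCA.
  by rewrite /lam /tensor_quotient divfK ?subrr // gt_eqF.
rewrite (gradient_tensor_quotient hA hB) ?gt_eqF // -/w in kkt.
set c := m.+1%:R / _ in kkt.
have c_gt0 : 0 < c by rewrite divr_gt0 // ltr0Sn.
have kktE i : c * w 0 i = alpha 0 i + beta.
  by move/rowP/(_ i): kkt; rewrite !mxE mulr1.
have beta0 : beta = 0.
  (* Complementarity removes the [alpha] part of this sum, and the unit sum of [xbar] leaves
     [beta]. *)
  transitivity (\sum_i (alpha 0 i + beta) * xbar 0 i).
    under eq_bigr do rewrite mulrDl.
    by rewrite big_split /= -mulr_sumr x_sum1 mulr1 [X in X + _]alphax add0r.
  transitivity (c * dot xbar w); last by rewrite xw mulr0.
  rewrite /dot [RHS]mulr_sumr; apply: eq_bigr => i _.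
  by rewrite -kktE mulrCA mulrC.
split=> // i.
(* With [beta] zero, [c * w 0 i] is [alpha 0 i], and [c] is positive. *)
by rewrite -(pmulr_rge0 _ c_gt0) kktE beta0 addr0.
Qed.
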